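(* Let $1\le k\le L$ and $a,x\ge0$. The conditional distribution of the minimum level reached by the fluid queue during $[0,\mathcal Y_k]$, given the initial level $a$ and the initial phase, is $$\boldsymbol\rho_+(a,x,k)=\boldsymbol\eta_+(x-a,k)\qquad\text{and}\qquad\boldsymbol\rho_-(a,x,k)=\boldsymbol\eta_-(x-a,k).$$
   Context: Random walk: $\{\varphi(t)\}_{t\ge0}$ is a continuous-time Markov chain on a finite set $\mathcal S$ (phases) with infinitesimal generator $A$; each phase $i$ has a rate $c_i\in\mathbb R\setminus\{0\}$; $\mathcal S_+=\{i:c_i>0\}$, $\mathcal S_-=\{i:c_i<0\}$. The unrestricted level is $X(t)=X(0)+\int_0^t c_{\varphi(s)}\,ds$. Fluid queue: the level with boundary at $0$ and initial level $a\ge0$ is $Z(t)=X(t)-\min\{0,\inf_{0\le v\le t}X(v)\}$ with $X(0)=a$ (it stays at $0$ as long as it is at $0$ and the current rate is negative). Erlang clock: $\nu>0$ and an integer $L\ge1$ are fixed; $Y_1,Y_2,\dots$ are i.i.d. exponential random variables with parameter $\nu$, independent of $\varphi$ and $X$; $\mathcal Y_k=\sum_{n=1}^kY_n$. $\mathbb P_i^a[\cdot]$ is the conditional probability given initial level $a$ and $\varphi(0)=i$. Let $m(t)=\min\{X(s):0\le s\le t\}$ and $m_0(t)=\min\{Z(v):0\le v\le t\}$. For $i\in\mathcal S$: $\eta_i(x,k)=\mathbb P_i^0[m(\mathcal Y_k)\le x]$ for $x\in\mathbb R$, and $\rho_i(a,x,k)=\mathbb P_i^a[m_0(\mathcal Y_k)\le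 x]$; the corresponding vectors have subvectors with subscripts $\pm$ indexed by $\mathcal S_\pm$. *)

(* Defs.v *)
From HB Require Import structures.
From mathcomp Require Import all_boot all_order all_algebra.
From mathcomp Require Import all_classical all_reals all_analysis.

Set Implicit Arguments.
Unset Strict Implicit.
Unset Printing Implicit Defensive.

Import Order.TTheory GRing.Theory Num.Theory.
Import numFieldNormedType.Exports.

Local Open Scope classical_set_scope.
Local Open Scope ring_scope.

Section markov_chain.
Context (R : realType) (S : finType).

Definition transition_function (p : R -> S -> S -> R) : Prop :=
  [/\ forall (t : R) i j, 0 <= t -> 0 <= p t i j,
      forall (t : R) i, 0 <= t -> \sum_j p t i j = 1,
      forall i j, p 0 i j = (i == j)%:R &
      forall (s t : R) i j, 0 <= s -> 0 <= t ->
        p (s + t) i j = \sum_l p s i l * p t l j].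

Definition infinitesimal_generator (A : S -> S -> R) (p : R -> S -> S -> R) :
    Prop :=
  forall i j, (p h i j - p 0 i j) / h @[h --> 0^'+] --> A i j.

Context (d : measure_display) (Omega : measurableType d).

(* The time-homogeneous Markov property P(future | past) = p(present, future),
   multiplied out so that conditioning events of probability zero need no
   separate treatment. *)
Definition markov_property (P : probability Omega R) (p : R -> S -> S -> R)
    (phi : R -> Omega -> S) : Prop :=
  forall (n : nat) (t : nat -> R) (j : nat -> S),
    0 <= t 0%N -> (forall l, (l <= n)%N -> t l < t l.+1) ->
    (P (\bigcap_(l < n.+2) [set w | phi (t l) w = j l]) =
     P (\bigcap_(l < n.+1) [set w | phi (t l) w = j l]) *
       (p (t n.+1 - t n) (j n) (j n.+1))%:E)%E.

(* Processes are indexed by R, but only times t >= 0 are meaningful.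
   S is discrete, so a right-continuous path is constant just after each time. *)
Definition continuous_time_markov_chain (P : probability Omega R)
    (A : S -> S -> R) (phi : R -> Omega -> S) : Prop :=
  [/\ forall (t : R) j, 0 <= t -> measurable [set w | phi t w = j],
      forall w (t : R), 0 <= t -> \forall s \near t^'+, phi s w = phi t w &
      exists p, [/\ transition_function p, infinitesimal_generator A p &
                    markov_property P p phi]].

End markov_chain.

Section levels.
Context (R : realType) (S : finType) (d : measure_display)
  (Omega : measurableType d).
Implicit Types (c : S -> R) (phi : R -> Omega -> S).

Definition level c phi (X0 : Omega -> R) (t : R) (w : Omega) : R :=
  X0 w + \int[lebesgue_measure]_(s in `[0, t]) c (phi s w).

(* For a path that is continuous on [0, t], which is the case of the two level
   processes below, the infimum is attained: this is the minimum over [0, t]. *)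
Definition running_min (Z : R -> Omega -> R) (t : R) (w : Omega) : R :=
  inf [set Z s w | s in `[0, t]].

Definition fluid_level c phi (X0 : Omega -> R) (t : R) (w : Omega) : R :=
  level c phi X0 t w - Num.min 0 (running_min (level c phi X0) t w).

Definition process_events c phi (X0 : Omega -> R) : set (set Omega) :=
  [set E | exists (t : R) j, 0 <= t /\ E = [set w | phi t w = j]] `|`
  [set E | exists (t : R) (B : set R), [/\ 0 <= t, measurable B &
                                    E = level c phi X0 t @^-1` B]].

Definition erlang_time (Y : nat -> {mfun Omega >-> R}) (k : nat) (w : Omega) :
    R :=
  \sum_(1 <= n < k.+1) Y n w.

(* Y 0 is not used: the exponential variables are Y 1, Y 2, ...  In the last
   clause F ranges over the sigma-algebra generated by phi and the level, and
   taking F or some B n to be the full set covers all finite subfamilies. *)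
Definition erlang_clock (P : probability Omega R) (nu : R)
    (Y : nat -> {mfun Omega >-> R}) c phi (X0 : Omega -> R) : Prop :=
  (forall n, (1 <= n)%N -> forall B : set R, measurable B ->
     distribution P (Y n) B = exponential_prob nu B) /\
  (forall (F : set Omega) (K : nat) (B : nat -> set R),
     <<s process_events c phi X0 >> F -> (forall n, measurable (B n)) ->
     (P (F `&` \bigcap_(n in [set n | (1 <= n <= K)%N]) (Y n @^-1` B n)) =
      P F * \prod_(1 <= n < K.+1) P (Y n @^-1` B n))%E).

(* The conditional law given initial level a and initial phase i is one member
   of a family of probabilities on Omega, as usual for Markov processes:
   conditioning on the value of a real variable is not elementary. *)
Record started_from (P : probability Omega R) (A : S -> S -> R) c (nu : R) phi
    (X0 : {mfun Omega >-> R}) (Y : nat -> {mfun Omega >-> R})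
    (a : R) (i : S) : Prop := StartedFrom {
  initial_level : P [set w | X0 w = a] = 1%E ;
  initial_phase : P [set w | phi 0 w = i] = 1%E ;
  phase_process : continuous_time_markov_chain P A phi ;
  clock_process : erlang_clock P nu Y c phi X0 }.

Definition eta_prob (P : R -> S -> probability Omega R) c phi (X0 : Omega -> R)
    (Y : nat -> {mfun Omega >-> R}) (x : R) (k : nat) (i : S) : \bar R :=
  P 0 i [set w | running_min (level c phi X0) (erlang_time Y k w) w <= x].

Definition rho_prob (P : R -> S -> probability Omega R) c phi (X0 : Omega -> R)
    (Y : nat -> {mfun Omega >-> R}) (a x : R) (k : nat) (i : S) : \bar R :=
  P a i [set w | running_min (fluid_level c phi X0) (erlang_time Y k w) w <= x].

Definition phases_up c : {set S} := [set i | 0 < c i]%SET.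
Definition phases_down c : {set S} := [set i | c i < 0]%SET.

Definition subvector (D : {set S}) (v : S -> \bar R) :
    {ffun {i : S | i \in D} -> \bar R} :=
  [ffun i => v (val i)].

End levels.

(* Main.v *)
Require Import Defs.
From HB Require Import structures.
From mathcomp Require Import all_boot all_order all_algebra.
From mathcomp Require Import all_classical all_reals all_analysis.
From mathcomp Require Import measurable_realfun.

Set Implicit Arguments.
Unset Strict Implicit.
Unset Printing Implicit Defensive.

Import Order.TTheory GRing.Theory Num.Theory.
Import numFieldNormedType.Exports.

Local Open Scope classical_set_scope.
Local Open Scope ring_scope.

(** The fluid level Z = X - min(0, min X) never falls below the free level X.
At a time m where X attains its minimum over the period, the correction is
exactly min(0, X m), so Z m = max(0, X m).  Hence min Z = max(0, min X), and
for x >= 0 the events [min Z <= x] and [min X <= x] are equal, path by path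
(lemma [running_min_fluid_le]).

It remains to compare the law started from level a with the law started from
level 0.  Write X = X0 + I, where I is the integral of the rates.  Under the
law started from a, X0 = a almost surely, so [min X <= x] becomes
[min I <= x - a], an event about the phases and the clock alone
([running_min_level_recenter]).  Its probability does not depend on the initial
level ([centred_running_min_law_unique]), although the two laws are a priori
unrelated probabilities on Omega, known only through the generator, the initial
phase and the distribution of the clock.  Three facts give this.

- A transition function on a finite set is determined by its generator: two of
  them with the same generator differ by o(h) at time h, and by stochasticity
  errors at most add up over the t / h steps that lead to t, which leaves
  o(1) ([transition_function_unique]).

- The finite-dimensional laws of the phase process are then determined, hence
  so is the law of (phi, Y 1, ..., Y k), because cylinder events are stable
  under intersection ([phase_clock_law_unique]).

- The event [min I <= y] over the Erlang period belongs to the sigma-algebra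
  generated by phi and Y 1, ..., Y k.  Right-continuity of the paths makes
  (s, w) |-> phi s w jointly measurable, so each I t is measurable by Fubini
  ([measurable_level]); and as I is continuous in t, its minimum is controlled
  by its values at rational times ([measurable_running_min_le]). *)

(** * Uniqueness of the transition function of a generator *)

(** Telescoping P^(n+1) - Q^(n+1) = P (P^n - Q^n) + (P - Q) Q^n: multiplying by
a stochastic matrix on either side does not increase the maximal l^1 norm of
the rows, so each step of length h contributes at most e. *)
Lemma transition_distance_mulrn (R : realType) (S : finType)
    (p q : R -> S -> S -> R) (h e : R) (n : nat) (i : S) :
  transition_function p -> transition_function q -> 0 <= h ->
  (forall i, \sum_j `|p h i j - q h i j| <= e) ->
  \sum_j `|p (h *+ n) i j - q (h *+ n) i j| <= e *+ n.
Proof.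
move=> [p_ge0 p_sum p0 pD] [q_ge0 q_sum q0 qD] h_ge0 pq_h.
elim: n i => [|n IHn] i.
  rewrite !mulr0n big1// => j _.
  by rewrite p0 q0 subrr normr0.
have hn_ge0 : 0 <= h *+ n by rewrite mulrn_wge0.
rewrite !mulrS.
have -> : \sum_j `|p (h + h *+ n) i j - q (h + h *+ n) i j| =
    \sum_j `|\sum_l (p h i l * (p (h *+ n) l j - q (h *+ n) l j) +
                     (p h i l - q h i l) * q (h *+ n) l j)|.
  apply: eq_bigr => j _; rewrite pD// qD// -sumrB; congr `|_|.
  by apply: eq_bigr => l _; rewrite mulrBr mulrBl addrA subrK.
apply: (@le_trans _ _ (\sum_j \sum_l
    (p h i l * `|p (h *+ n) l j - q (h *+ n) l j| +
     `|p h i l - q h i l| * q (h *+ n) l j))).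
  apply: ler_sum => j _; apply: (le_trans (ler_norm_sum _ _ _)).
  apply: ler_sum => l _; apply: (le_trans (ler_normD _ _)).
  by rewrite !normrM (ger0_norm (p_ge0 _ _ _ _))// (ger0_norm (q_ge0 _ _ _ _)).
rewrite exchange_big/=.
under eq_bigr do rewrite big_split/= -!mulr_sumr q_sum// mulr1.
rewrite big_split/= addrC lerD//.
have -> : e *+ n = \sum_l p h i l * (e *+ n).
  by rewrite -mulr_suml p_sum// mul1r.
by apply: ler_sum => l _; rewrite ler_wpM2l// p_ge0.
Qed.

Lemma transition_distance_near0 (R : realType) (S : finType) (A : S -> S -> R)
    (p q : R -> S -> S -> R) (e : R) :
  transition_function p -> transition_function q ->
  infinitesimal_generator A p -> infinitesimal_generator A q -> 0 < e ->
  \forall h \near 0^'+, forall i j, `|p h i j - q h i j| <= e * h.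
Proof.
move=> [_ _ p0 _] [_ _ q0 _] Ap Aq e_gt0.
apply: filter_forall => i; apply: filter_forall => j.
have pq_cvg : (p h i j - q h i j) / h @[h --> 0^'+] --> (0 : R).
  have -> : (fun h => (p h i j - q h i j) / h) =
      (fun h => (p h i j - p 0 i j) / h - (q h i j - q 0 i j) / h).
    by apply/funext => h; rewrite p0 q0 -mulrBl opprB addrA subrK.
  by rewrite -[X in _ --> X](subrr (A i j)); apply: cvgB; [exact: Ap|exact: Aq].
move/cvgrPdist_le/(_ _ e_gt0) : pq_cvg => pq_cvg.
near=> h.
have h_gt0 : 0 < h by near: h; exact: nbhs_right_gt.
have : `|0 - (p h i j - q h i j) / h| <= e by near: h.
by rewrite sub0r normrN normrM normfV (gtr0_norm h_gt0) ler_pdivrMr.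
Unshelve. all: by end_near. Qed.

(** The distance at time t is at most n times the distance at time t / n, which
is at most #|S| * e * (t / n) for n large.  This avoids solving the Kolmogorov
equations. *)
Lemma transition_function_unique (R : realType) (S : finType)
    (A : S -> S -> R) (p q : R -> S -> S -> R) (t : R) (i j : S) :
  transition_function p -> transition_function q ->
  infinitesimal_generator A p -> infinitesimal_generator A q -> 0 <= t ->
  p t i j = q t i j.
Proof.
move=> tp tq Ap Aq t_ge0.
suff pq_le e : 0 < e -> `|p t i j - q t i j| <= #|S|%:R * e * t.
  apply/eqP; rewrite -subr_eq0 -normr_le0; apply/ler_addgt0Pr => e e_gt0.
  rewrite add0r.
  have K_gt0 : 0 < #|S|%:R * t + 1 by rewrite ltr_wpDl// mulr_ge0.
  apply: (le_trans (pq_le (e / (#|S|%:R * t + 1)) _)); first exact: divr_gt0.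
  rewrite mulrAC mulrA ler_pdivrMr// mulrC ler_wpM2l ?ltW//.
  by rewrite ltrDl.
move=> e_gt0.
have [d /= d_gt0 near_pq] := transition_distance_near0 tp tq Ap Aq e_gt0.
move: t_ge0; rewrite le_eqVlt => /predU1P[<-|t_gt0].
  by case: tp tq => [_ _ -> _] [_ _ -> _]; rewrite subrr normr0 mulr0.
(* This n makes the step t / n fall below d. *)
pose n := (Num.truncn (t / d)).+1.
have n_gt0 : 0 < n%:R :> R by rewrite ltr0n.
pose h := t / n%:R.
have h_gt0 : 0 < h by exact: divr_gt0.
have h_lt : h < d.
  by rewrite ltr_pdivrMr// mulrC -ltr_pdivrMr// truncnS_gt.
have hn : h *+ n = t by rewrite -mulr_natr divfK// gt_eqF.
have pq_h l : \sum_m `|p h l m - q h l m| <= #|S|%:R * e * h.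
  apply: (@le_trans _ _ (\sum_(m : S) e * h)).
    apply: ler_sum => m _; apply: near_pq => //=.
    by rewrite sub0r normrN gtr0_norm.
  by rewrite sumr_const -mulrA mulr_natl.
have := transition_distance_mulrn n i tp tq (ltW h_gt0) pq_h.
rewrite hn -mulrnAr hn; apply: le_trans.
by rewrite (bigD1 j)//= lerDl sumr_ge0.
Qed.

(** * Uniqueness of the joint law of the phases and the clock *)

Lemma eq_probability_almost_surely (R : realType) (d : measure_display)
    (T : measurableType d) (P : probability T R) (C E F : set T) :
  measurable C -> measurable E -> measurable F -> P C = 1%E ->
  E `&` C = F `&` C -> P E = P F.
Proof.
move=> mC mE mF PC EF.
have PC0 : P (~` C) = 0%E by rewrite probability_setC// PC subee.
have restrict G : measurable G -> P G = P (G `&` C).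
  move=> mG; rewrite -[in LHS](setIT G) -(setUv C) setIUr measureU//.
  - rewrite [X in (_ + X)%E](_ : _ = 0%E) ?adde0//.
    apply: (@subset_measure0 _ _ _ P _ (~` C)) PC0.
    + exact: measurableI _ _ mG (measurableC mC).
    + exact: measurableC.
    + exact: subIsetr.
  - exact: measurableI.
  - exact: measurableI _ _ mG (measurableC mC).
  - by rewrite setIACA setICr setI0.
by rewrite (restrict E)// (restrict F)// EF.
Qed.

(** A list of pairs may prescribe several phases at the same time, and in any
order; this makes intersection of cylinders a concatenation of lists. *)
Definition phase_cylinder (R : realType) (S : finType) (T : Type)
    (phi : R -> T -> S) (s : seq (R * S)) : set T :=
  [set w | forall u, u \in s -> phi u.1 w = u.2].

Lemma phase_cylinder_cons (R : realType) (S : finType) (T : Type)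
    (phi : R -> T -> S) (u : R * S) (s : seq (R * S)) :
  phase_cylinder phi (u :: s) =
    [set w | phi u.1 w = u.2] `&` phase_cylinder phi s.
Proof.
apply/seteqP; split=> [w us|w [uw sw] v].
  split; first by apply: us; rewrite mem_head.
  by move=> v vs; apply: us; rewrite inE vs orbT.
by rewrite inE => /predU1P[->//|]; exact: sw.
Qed.

Lemma phase_cylinder_cat (R : realType) (S : finType) (T : Type)
    (phi : R -> T -> S) (s s' : seq (R * S)) :
  phase_cylinder phi (s ++ s') =
    phase_cylinder phi s `&` phase_cylinder phi s'.
Proof.
elim: s => [|u s IHs] /=; last by rewrite !phase_cylinder_cons IHs setIA.
by rewrite [X in X `&` _](_ : _ = setT) ?setTI//; apply/seteqP; split.
Qed.

Lemma measurable_phase_cylinder (R : realType) (S : finType)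
    (d : measure_display) (T : measurableType d) (phi : R -> T -> S)
    (s : seq (R * S)) :
  (forall (t : R) j, 0 <= t -> measurable [set w | phi t w = j]) ->
  (forall u, u \in s -> 0 <= u.1) -> measurable (phase_cylinder phi s).
Proof.
move=> mphi; elim: s => [|u s IHs] s_ge0.
  by rewrite (_ : phase_cylinder _ _ = setT)//; apply/seteqP; split.
rewrite phase_cylinder_cons; apply: measurableI.
  by apply: mphi; apply: s_ge0; rewrite mem_head.
by apply: IHs => v vs; apply: s_ge0; rewrite inE vs orbT.
Qed.

(** The Markov property gives the law of the path at increasing times as a
product of transition probabilities, so it depends on the initial law and on
the generator only. *)
Lemma markov_path_law_unique (R : realType) (S : finType)
    (d : measure_display) (Omega : measurableType d)
    (P Q : probability Omega R) (A : S -> S -> R) (phi : R -> Omega -> S)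
    (t : nat -> R) (j : nat -> S) (n : nat) :
  continuous_time_markov_chain P A phi ->
  continuous_time_markov_chain Q A phi ->
  (forall j, P [set w | phi 0 w = j] = Q [set w | phi 0 w = j]) ->
  t 0%N = 0 -> (forall l, (l < n)%N -> t l < t l.+1) ->
  P (\bigcap_(l < n.+1) [set w | phi (t l) w = j l]) =
    Q (\bigcap_(l < n.+1) [set w | phi (t l) w = j l]).
Proof.
move=> [_ _ [p [tp Ap Mp]]] [_ _ [q [tq Aq Mq]]] PQ0 t0.
elim: n => [|n IHn] t_inc.
  by rewrite bigcap_mkord big_ord1 t0.
rewrite Mp ?t0// Mq ?t0// IHn; last by move=> l ln; apply/t_inc/ltnW.
congr (_ * _%:E)%E; apply: transition_function_unique tp tq Ap Aq _.
by rewrite subr_ge0 ltW// t_inc.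
Qed.

(** A non-empty cylinder is the event that the path agrees with one of its
members [w0] at the prescribed times; in this form the times can be sorted
without repetition, which reduces the claim to [markov_path_law_unique]. *)
Lemma markov_cylinder_law_unique (R : realType) (S : finType)
    (d : measure_display) (Omega : measurableType d)
    (P Q : probability Omega R) (A : S -> S -> R) (phi : R -> Omega -> S)
    (i : S) (s : seq (R * S)) :
  continuous_time_markov_chain P A phi ->
  continuous_time_markov_chain Q A phi ->
  P [set w | phi 0 w = i] = 1%E -> Q [set w | phi 0 w = i] = 1%E ->
  (forall u, u \in s -> 0 <= u.1) ->
  P (phase_cylinder phi s) = Q (phase_cylinder phi s).
Proof.
move=> chainP chainQ Pi Qi s_ge0.
have [mphi _ _] := chainP.
have mi : measurable [set w | phi 0 w = i] by exact: mphi.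
have PQ0 j : P [set w | phi 0 w = j] = Q [set w | phi 0 w = j].
  have [<-|ji] := eqVneq i j; first by rewrite Pi Qi.
  have eq0 (M : probability Omega R) : M [set w | phi 0 w = i] = 1%E ->
      M [set w | phi 0 w = j] = M set0.
    move=> Mi; apply: (eq_probability_almost_surely mi) => //.
      exact: mphi.
    rewrite set0I; apply/seteqP; split => // w /= [-> /esym/eqP].
    by rewrite (negbTE ji).
  by rewrite !eq0// !measure0.
(* Time 0 is added to the prescribed times, so that paths start there. *)
pose s0 := (0, i) :: s.
have s0_ge0 u : u \in s0 -> 0 <= u.1.
  by rewrite inE => /predU1P[->//|]; exact: s_ge0.
have add0 (M : probability Omega R) : M [set w | phi 0 w = i] = 1%E ->
    M (phase_cylinder phi s) = M (phase_cylinder phi s0).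
  move=> Mi; apply: (eq_probability_almost_surely mi) => //.
  - exact: measurable_phase_cylinder.
  - exact: measurable_phase_cylinder.
  - by rewrite phase_cylinder_cons setIAC setIid setIC.
rewrite !add0//.
have [->|/set0P[w0 w0s]] := eqVneq (phase_cylinder phi s0) set0.
  by rewrite !measure0.
pose ts := sort <=%R (undup [seq u.1 | u <- s0]).
have mem_ts t : (t \in ts) = (t \in [seq u.1 | u <- s0]).
  by rewrite mem_sort mem_undup.
have ts_sorted : sorted <%R ts.
  by rewrite lt_sorted_uniq_le sort_uniq undup_uniq sort_le_sorted.
have ts0 : 0 \in ts by rewrite mem_ts mem_head.
have [n sz_ts] : exists n, size ts = n.+1.
  by case: ts ts0 {mem_ts ts_sorted} => // t ts' _; exists (size ts').
have t0 : nth 0 ts 0 = 0.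
  apply/le_anti/andP; split; last first.
    have : nth 0 ts 0 \in ts by rewrite mem_nth// sz_ts.
    by rewrite mem_ts => /mapP[u us ->]; exact: s0_ge0.
  case: ts ts_sorted ts0 {mem_ts sz_ts} => // t ts' /=.
  rewrite inE => t_path /predU1P[->//|ts'0].
  by have /allP/(_ _ ts'0)/ltW := order_path_min lt_trans t_path.
have -> : phase_cylinder phi s0 = \bigcap_(l < n.+1)
    [set w | phi (nth 0 ts l) w = phi (nth 0 ts l) w0].
  rewrite -sz_ts; apply/seteqP; split=> w.
    move=> sw l /= lts; have : nth 0 ts l \in ts by rewrite mem_nth.
    by rewrite mem_ts => /mapP[u us ->]; rewrite sw// w0s.
  move=> tw u us; have u_ts : u.1 \in ts by rewrite mem_ts map_f.
  have /= := tw (index u.1 ts); rewrite nth_index// index_mem => ->//.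
  exact: w0s.
apply: (markov_path_law_unique _ chainP chainQ) => // l ln.
by move/sortedP : ts_sorted; apply; rewrite sz_ts.
Qed.

(** A pi-system generating the sigma-algebra of the phases and of the first [k]
clock variables. *)
Definition phase_clock_events (R : realType) (S : finType) (T : Type)
    (phi : R -> T -> S) (Y : nat -> T -> R) (k : nat) : set (set T) :=
  [set E | exists (s : seq (R * S)) (B : nat -> set R),
    [/\ forall u, u \in s -> 0 <= u.1, forall n, measurable (B n) &
        E = phase_cylinder phi s `&`
            \bigcap_(n in [set n | (1 <= n <= k)%N]) (Y n @^-1` B n)]].

Lemma setI_closed_phase_clock_events (R : realType) (S : finType) (T : Type)
    (phi : R -> T -> S) (Y : nat -> T -> R) (k : nat) :
  setI_closed (phase_clock_events phi Y k).
Proof.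
move=> _ _ [s [B [s_ge0 mB ->]]] [s' [B' [s'_ge0 mB' ->]]].
exists (s ++ s'), (fun n => B n `&` B' n); split.
- by move=> u; rewrite mem_cat => /orP[]; [exact: s_ge0|exact: s'_ge0].
- by move=> n; exact: measurableI.
- by rewrite phase_cylinder_cat setIACA -bigcapI.
Qed.

(** Independence turns the probability of a member of the pi-system into the
probability of a phase cylinder times exponential probabilities, both of which
are common to [P] and [Q] whatever the initial levels; Dynkin's theorem
concludes. *)
Lemma phase_clock_law_unique (R : realType) (S : finType)
    (A : S -> S -> R) (c : S -> R) (nu : R)
    (d : measure_display) (Omega : measurableType d)
    (P Q : probability Omega R) (phi : R -> Omega -> S)
    (X0 : {mfun Omega >-> R}) (Y : nat -> {mfun Omega >-> R})
    (a b : R) (i : S) (k : nat) (E : set Omega) :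
  started_from P A c nu phi X0 Y a i -> started_from Q A c nu phi X0 Y b i ->
  <<s phase_clock_events phi Y k >> E -> P E = Q E.
Proof.
move=> [_ Pi chainP [expP indP]] [_ Qi chainQ [expQ indQ]].
have [mphi _ _] := chainP.
have setT_event : phase_clock_events phi Y k setT.
  exists [::], (fun=> setT); split => //.
  by apply/seteqP; split => // w _; split.
apply: (@g_sigma_algebra_measure_unique _ _ _ (phase_clock_events phi Y k) _
  (fun=> setT)) => //.
- move=> _ [s [B [s_ge0 mB ->]]]; apply: measurableI.
    exact: measurable_phase_cylinder.
  apply: bigcap_measurableType => n _.
  by rewrite -[X in measurable X]setTI; exact: measurable_funP.
- by rewrite bigcup_const//; exists 0%N.
- exact: setI_closed_phase_clock_events.
- move=> _ [s [B [s_ge0 mB ->]]].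
  have s_event : <<s process_events c phi X0 >> (phase_cylinder phi s).
    apply: (@measurable_phase_cylinder _ _ _
      (g_sigma_algebraType (process_events c phi X0)) phi s) => // t j t_ge0.
    by apply: sub_sigma_algebra; left; exists t, j.
  apply: (etrans (indP _ k B s_event mB)); apply/esym.
  apply: (etrans (indQ _ k B s_event mB)).
  rewrite (markov_cylinder_law_unique chainQ chainP Qi Pi)//; congr (_ * _)%E.
  rewrite big_nat_cond [in RHS]big_nat_cond.
  apply: eq_bigr => n /andP[/andP[n_ge1 _] _].
  by exact: etrans (expQ n n_ge1 _ (mB n)) (esym (expP n n_ge1 _ (mB n))).
- move=> n; apply: (le_lt_trans (@probability_le1 _ _ _ P _ _)) => //.
  by rewrite ltry.
Qed.

(** * Measurability and continuity of the free level *)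

(** As the phases are discrete, phi s w = j holds if and only if phi q w = j for
all rational q in some interval ]s, s + 1/(m+1)[: right-continuity carries the
phase from s to such q and back.  This expresses the set by countably many
measurable rectangles. *)
Lemma measurable_right_continuous_process (R : realType) (S : finType)
    (d : measure_display) (T : measurableType d) (phi : R -> T -> S) (j : S) :
  (forall (t : R) j, 0 <= t -> measurable [set w | phi t w = j]) ->
  (forall w (t : R), 0 <= t -> \forall s \near t^'+, phi s w = phi t w) ->
  measurable [set u : measurableTypeR R * T | 0 <= u.1 /\ phi u.1 u.2 = j].
Proof.
move=> mphi rc_phi.
(* [N m q] collects the (s, w) for which q witnesses that phi is not constantly
   j on the interval ]s, s + 1/(m+1)[. *)
pose N (m : nat) (q : rat) : set (measurableTypeR R * T) :=
  [set s | s < ratr q < s + m.+1%:R^-1] `*` ~` [set w | phi (ratr q) w = j].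
have -> : [set u : measurableTypeR R * T | 0 <= u.1 /\ phi u.1 u.2 = j] =
    (`[0, +oo[ `*` setT) `&`
      \bigcup_m ~` (\bigcup_(q in [set q | 0 <= q]) N m q).
  apply/seteqP; split=> -[s w] /=.
    move=> [s_ge0 sw]; split; first by rewrite in_itv/= s_ge0.
    have [e /= e_gt0 near_s] := rc_phi w s s_ge0.
    exists (Num.truncn e^-1) => // -[q _] [/= /andP[sq qs]]; apply.
    rewrite near_s//= ltr_distlC; apply/andP; split.
      by rewrite (lt_trans _ sq)// ltrBlDr ltrDl.
    rewrite (lt_trans qs)// ltrD2l -[ltRHS]invrK ltf_pV2 ?posrE ?invr_gt0//.
    exact: truncnS_gt.
  move=> [[+ _] [m _ /= no_q]]; rewrite in_itv/= andbT => s_ge0; split => //.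
  have [e /= e_gt0 near_s] := rc_phi w s s_ge0.
  have m_gt0 : 0 < m.+1%:R^-1 :> R by rewrite invr_gt0.
  have [q] : exists q, ratr q \in `]s, s + Num.min e m.+1%:R^-1[.
    by apply: rat_in_itvoo; rewrite ltrDl lt_min e_gt0.
  rewrite in_itv/= -ltrBlDl lt_min => /andP[sq /andP[qe qm]].
  rewrite -(near_s (ratr q))//=; last first.
    by rewrite distrC gtr0_norm// subr_gt0.
  apply: contrapT => phi_q; apply: no_q; exists q => /=.
    by rewrite -(ler0q R) ltW// (le_lt_trans s_ge0).
  by split => //=; rewrite sq -ltrBlDl.
apply: measurableI; first exact: measurableX.
apply: bigcupT_measurable => m; apply: measurableC.
rewrite bigcup_mkcond; apply: bigcupT_measurable_rat => q.
case: ifPn => // /[!inE] /= q_ge0; apply: measurableX.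
  rewrite (_ : [set _ | _] = `]ratr q - m.+1%:R^-1, ratr q[%classic)//.
  by apply/seteqP; split=> s /=; rewrite in_itv/= ltrBlDr andbC.
by apply: measurableC; apply: mphi; rewrite ler0q.
Qed.

(** The integrand of the level at time [t], as a function on the product space
extended by 0, for use with Fubini's theorem. *)
Definition stopped_rate (R : realType) (S : finType) (c : S -> R) (T : Type)
    (phi : R -> T -> S) (t : R) : measurableTypeR R * T -> R :=
  (fun u => c (phi u.1 u.2)) \_ (`[0, t] `*` setT).

Lemma measurable_stopped_rate (R : realType) (S : finType) (c : S -> R)
    (d : measure_display) (T : measurableType d) (phi : R -> T -> S)
    (t : R) :
  (forall (t : R) j, 0 <= t -> measurable [set w | phi t w = j]) ->
  (forall w (t : R), 0 <= t -> \forall s \near t^'+, phi s w = phi t w) ->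
  measurable_fun setT (stopped_rate c phi t).
Proof.
move=> mphi rc_phi.
have mD : measurable (`[0, t]%classic `*` setT : set (measurableTypeR R * T)).
  exact: measurableX.
apply/(measurable_restrictT _ mD) => _ B mB.
rewrite (_ : _ `&` _ = (`[0, t] `*` setT) `&` \bigcup_(j in [set j | B (c j)])
    [set u : measurableTypeR R * T | 0 <= u.1 /\ phi u.1 u.2 = j]); last first.
  apply/seteqP; split=> -[s w] /= [[+ _] Bs]; rewrite in_itv/= => /andP[s0 st].
    by rewrite s0 st; split => //; exists (phi s w).
  by case: Bs => j Bj [_ sw]; rewrite sw s0 st.
apply: measurableI => //; apply: fin_bigcup_measurable => [|j _].
  exact: finite_finset.
exact: measurable_right_continuous_process.
Qed.

Lemma stopped_rateE (R : realType) (S : finType) (c : S -> R) (T : Type)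
    (phi : R -> T -> S) (t : R) (w : T) :
  (fun s => stopped_rate c phi t (s, w)) = (fun s => c (phi s w)) \_ `[0, t].
Proof.
by apply/funext => s; rewrite /stopped_rate !patchE in_setX in_setT andbT.
Qed.

(** The integral of the rates is the difference of the integrals of their
positive and negative parts, each measurable in w by Tonelli's theorem. *)
Lemma measurable_level (R : realType) (S : finType) (c : S -> R)
    (d : measure_display) (T : measurableType d) (phi : R -> T -> S)
    (X0 : T -> R) (t : R) :
  (forall (t : R) j, 0 <= t -> measurable [set w | phi t w = j]) ->
  (forall w (t : R), 0 <= t -> \forall s \near t^'+, phi s w = phi t w) ->
  measurable_fun setT X0 -> measurable_fun setT (level c phi X0 t).
Proof.
move=> mphi rc_phi mX0; apply: measurable_funD => //.
pose I (w : T) : \bar R :=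
  (\int[lebesgue_measure]_s (EFin \o stopped_rate c phi t)^\+ (s, w) -
   \int[lebesgue_measure]_s (EFin \o stopped_rate c phi t)^\- (s, w))%E.
have mI : measurable_fun setT I.
  have mrate : measurable_fun setT (EFin \o stopped_rate c phi t).
    by apply/measurable_EFinP; exact: measurable_stopped_rate.
  apply: emeasurable_funB.
    apply: (@measurable_fun_fubini_tonelli_G _ _ _ _ _ lebesgue_measure) => //.
    exact: measurable_funepos.
  apply: (@measurable_fun_fubini_tonelli_G _ _ _ _ _ lebesgue_measure) => //.
  exact: measurable_funeneg.
have -> : (fun w => \int[lebesgue_measure]_(s in `[0, t]) c (phi s w)) =
    fine \o I.
  apply/funext => w; rewrite /Rintegral integral_mkcond integralE.
  have -> : (fun s => (c (phi s w))%:E) \_ `[0, t] =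
      (fun s => (EFin \o stopped_rate c phi t) (s, w)).
    apply/funext => s /=; rewrite -[stopped_rate _ _ _ _]/
      ((fun s => stopped_rate c phi t (s, w)) s) stopped_rateE.
    by rewrite !patchE; case: ifP.
  by congr (fine (_ - _)%E); apply: eq_integral => s _; rewrite !unlock.
exact: measurableT_comp mI.
Qed.

(** There are finitely many rates, so the integrand is bounded and the level is
an integral depending on its upper bound. *)
Lemma continuous_level (R : realType) (S : finType) (c : S -> R)
    (d : measure_display) (T : measurableType d) (phi : R -> T -> S)
    (X0 : T -> R) (b : R) (w : T) :
  (forall (t : R) j, 0 <= t -> measurable [set w | phi t w = j]) ->
  (forall w (t : R), 0 <= t -> \forall s \near t^'+, phi s w = phi t w) ->
  0 <= b ->
  {within `[0, b], continuous (fun t => level c phi X0 t w)}.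
Proof.
move=> mphi rc_phi b_ge0 t.
apply: cvgD; first exact: cvg_cst.
apply: (@parameterized_integral_continuous _ 0 b (fun s => c (phi s w))) => //.
apply: measurable_bounded_integrable => //.
- by rewrite /= lebesgue_measure_itv/=; case: ifP => _; rewrite ltry.
- apply/(measurable_restrictT _) => //.
  rewrite [X in measurable_fun _ X](_ : _ =
    fun s => stopped_rate c phi b (s, w)); last by rewrite stopped_rateE.
  apply: measurable_fun_pair1.
  exact: measurable_stopped_rate.
- exists (\sum_i `|c i|); split => [|M cM s _ /=]; first exact: num_real.
  by rewrite ltW// (le_lt_trans _ cM)// (bigD1 (phi s w))//= lerDl sumr_ge0.
Qed.

(** * Running minima *)

(** Continuity on a compact interval: the infimum is attained.  All comparisons
of running minima below go through this form. *)
Lemma running_min_leP (R : realType) (d : measure_display)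
    (T : measurableType d) (Z : R -> T -> R) (t x : R)
    (w : T) :
  0 <= t -> {within `[0, t], continuous (Z ^~ w)} ->
  running_min Z t w <= x <-> exists2 s, 0 <= s <= t & Z s w <= x.
Proof.
move=> t_ge0 cZ; have [m + Zm] := EVT_min t_ge0 cZ.
rewrite in_itv/= => m_t.
have -> : running_min Z t w = Z m w.
  apply/le_anti/andP; split.
    apply: ge_inf; last by exists m => //=; rewrite in_itv.
    by exists (Z m w) => _ [s /= s_t <-]; exact: Zm.
  apply: lb_le_inf; first by exists (Z m w), m => //=; rewrite in_itv.
  by move=> _ [s /= s_t <-]; exact: Zm.
split=> [Zmx|[s s_t Zsx]]; first by exists m.
by apply: le_trans Zsx; apply: Zm; rewrite in_itv.
Qed.

(** The infimum of the empty set is 0.  This convention matters because the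
Erlang time is nonnegative only almost surely. *)
Lemma running_min_lt0 (R : realType) (d : measure_display)
    (T : measurableType d) (Z : R -> T -> R) (t : R)
    (w : T) : t < 0 -> running_min Z t w = 0.
Proof.
move=> t_lt0; rewrite /running_min set_itv_ge ?image_set0 ?inf0//.
by rewrite bnd_simp -ltNge.
Qed.

(** Since Z >= X, a low value of Z gives a low value of X.  Conversely, at a time
[m] where X is minimal over [0, t], hence also over [0, m], the correction
min(0, min X) equals min(0, X m), so that Z m = max(0, X m). *)
Lemma running_min_fluid_le (R : realType) (S : finType) (c : S -> R)
    (d : measure_display)
    (T : measurableType d) (phi : R -> T -> S) (X0 : T -> R) (t x : R) (w : T) :
  0 <= x ->
  (forall b, 0 <= b ->
    {within `[0, b], continuous (fun s => level c phi X0 s w)}) ->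
  (running_min (fluid_level c phi X0) t w <= x) =
    (running_min (level c phi X0) t w <= x).
Proof.
move=> x_ge0 cX; set X := level c phi X0.
have [t_lt0|t_ge0] := ltP t 0; first by rewrite !running_min_lt0.
have minX s r : 0 <= r <= s -> running_min X s w <= X r w.
  move=> rs; apply/running_min_leP; [|apply: cX|exists r => //];
    by case/andP: rs => /le_trans; apply.
have Z_ge s : 0 <= s -> X s w <= fluid_level c phi X0 s w.
  by move=> s_ge0; rewrite /fluid_level lerDl oppr_ge0 ge_min lexx.
have Z_ge0 s : 0 <= s -> 0 <= fluid_level c phi X0 s w.
  move=> s_ge0; rewrite /fluid_level subr_ge0 ge_min.
  by rewrite minX ?orbT// s_ge0 lexx.
apply/idP/idP => [Zx|].
  apply: le_trans Zx; apply: lb_le_inf.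
    by exists (fluid_level c phi X0 0 w), 0 => //=; rewrite in_itv/= lexx.
  move=> _ [s + <-]; rewrite /= in_itv/= => /andP[s_ge0 st].
  by apply: le_trans (Z_ge s s_ge0); apply: minX; rewrite s_ge0.
move=> /(running_min_leP _ t_ge0 (cX t t_ge0))[r r_t Xrx].
have [m m_t Xm] := proj1 (running_min_leP (running_min X t w) t_ge0
  (cX t t_ge0)) (lexx _).
have [m_ge0 mt] := andP m_t.
have Zm : fluid_level c phi X0 m w <= x.
  rewrite /fluid_level lerBlDr -lerBlDl le_min lerBlDl addr0.
  have Xmx : X m w <= x by rewrite (le_trans Xm)// (le_trans (minX _ _ r_t)).
  rewrite Xmx/=.
  (* X m is also the minimum over [0, m]. *)
  have [s /andP[s_ge0 sm] Xs] := proj1 (running_min_leP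
    (running_min X m w) m_ge0 (cX m m_ge0)) (lexx _).
  apply: le_trans Xs; rewrite lerBlDr ler_wpDr//.
  by rewrite (le_trans Xm)// minX// s_ge0 (le_trans sm).
apply: le_trans Zm; apply: ge_inf.
  by exists 0 => _ [s + <-]; rewrite /= in_itv/= => /andP[s_ge0 _]; exact: Z_ge0.
by exists m => //=; rewrite in_itv.
Qed.

(** Attainment of the minimum makes V <= x somewhere on [0, tau] equivalent to:
for every n, V < x + 1/(n+1) somewhere on [0, tau].  By continuity the latter
strict inequality can be tested at rational times of [0, tau] only, which is a
countable condition on the variables V q and tau. *)
Lemma measurable_running_min_le (R : realType) (d : measure_display)
    (T : measurableType d) (V : R -> T -> R) (tau : T -> R) (x : R) :
  (forall t, 0 <= t -> measurable_fun setT (V t)) ->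
  (forall b w, 0 <= b -> {within `[0, b], continuous (V ^~ w)}) ->
  measurable_fun setT tau ->
  measurable [set w | running_min V (tau w) w <= x].
Proof.
move=> mV cV mtau.
have m_le (f g : T -> R) : measurable_fun setT f -> measurable_fun setT g ->
    measurable [set w | f w <= g w].
  move=> mf mg; rewrite -[X in measurable X]setTI.
  exact: measurable_fun_le.
have m_lt (f g : T -> R) : measurable_fun setT f -> measurable_fun setT g ->
    measurable [set w | f w < g w].
  move=> mf mg; rewrite (_ : mkset _ = ~` [set w | g w <= f w]).
    by apply: measurableC; exact: m_le.
  by apply/seteqP; split=> w /=; rewrite ltNge => /negP.
have -> : [set w | running_min V (tau w) w <= x] =
    ([set w | tau w < 0] `&` [set _ | 0 <= x]) `|`
    ([set w | 0 <= tau w] `&` \bigcap_n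
      \bigcup_(q in [set q : rat | 0 <= q])
        ([set w | ratr q <= tau w] `&` [set w | V (ratr q) w < x + n.+1%:R^-1])).
  apply/seteqP; split=> w /=.
    have [tau_lt0|tau_ge0] := ltP (tau w) 0.
      by rewrite running_min_lt0//; left.
    move=> /(running_min_leP _ tau_ge0 (cV _ w tau_ge0)).
    move=> [s /andP[s_ge0 s_tau] Vx].
    right; split => // n _.
    have Vxn : V s w < x + n.+1%:R^-1 by rewrite (le_lt_trans Vx)// ltrDl.
    move: s_ge0; rewrite le_eqVlt => /predU1P[s0|s_gt0].
      (* The interval [0, tau] may be reduced to 0, which is rational. *)
      by exists 0 => //=; rewrite rmorph0 s0.
    have s_in : `[0, tau w]%classic s by rewrite /= in_itv/= ltW.
    have /subspace_continuousP/(_ s s_in) cVs := cV (tau w) w tau_ge0.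
    have [e /= e_gt0 near_s] := cvgr_lt _ cVs _ Vxn.
    have [q] : exists q, ratr q \in `]Num.max 0 (s - e), s[.
      by apply: rat_in_itvoo; rewrite gt_max s_gt0 ltrBlDr ltrDl.
    rewrite in_itv/= gt_max => /andP[/andP[q_gt0 eq_s] qs].
    have q_tau : ratr q <= tau w by rewrite (le_trans (ltW qs)).
    exists q; first by rewrite /= -(ler0q R) ltW.
    split => //=; apply: near_s => /=; last by rewrite in_itv/= (ltW q_gt0).
    by rewrite gtr0_norm ?subr_gt0// ltrBlDl -ltrBlDr.
  case=> [[tau_lt0 x_ge0]|[tau_ge0 Vx]]; first by rewrite running_min_lt0.
  apply/ler_addgt0Pr => e e_gt0.
  have [q /= q_ge0 [q_tau Vq]] := Vx (Num.truncn e^-1) I.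
  apply/(running_min_leP _ tau_ge0 (cV _ w tau_ge0)); exists (ratr q).
    by rewrite q_tau ler0q q_ge0.
  rewrite (le_trans (ltW Vq))// lerD2l -[leRHS]invrK lef_pV2 ?posrE ?invr_gt0//.
  by rewrite ltW// truncnS_gt.
apply: measurableU.
  apply: measurableI; first exact: (m_lt tau (cst 0)).
  exact: (m_le (cst 0) (cst x)).
apply: measurableI; first exact: (m_le (cst 0)).
apply: bigcapT_measurable => n.
rewrite bigcup_mkcond; apply: bigcupT_measurable_rat => q.
case: ifPn => // /[!inE] /= q_ge0; apply: measurableI; first exact: (m_le (cst _)).
by apply: (m_lt _ (cst _)) => //; apply: mV; rewrite ler0q.
Qed.

(** * Dependence on the initial level *)

Lemma exponential_prob_itv0y (R : realType) (nu : R) :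
  0 < nu -> exponential_prob nu `[0, +oo[ = 1%E.
Proof.
move=> nu_gt0; rewrite -(integral_exponential_pdf nu_gt0).
rewrite /exponential_prob integral_mkcond; apply: eq_integral => t _.
by rewrite patchE /exponential_pdf patchE; case: ifP => [->|].
Qed.

(** The map [f] allows the clock to be read on a space with another
sigma-algebra: with [f] the identity, [T] will be [Omega] endowed with the
sigma-algebra generated by the phases and the clock. *)
Lemma measurable_erlang_time (R : realType) (d d' : measure_display)
    (Omega : measurableType d) (T : measurableType d') (f : T -> Omega)
    (Y : nat -> {mfun Omega >-> R}) (k : nat) :
  (forall n, (1 <= n <= k)%N -> measurable_fun setT (Y n \o f)) ->
  measurable_fun setT (erlang_time Y k \o f).
Proof.
move=> mY.
rewrite (_ : _ \o _ = fun w => \sum_(n <- index_iota 1 k.+1)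
    (if (1 <= n <= k)%N then Y n \o f else cst 0) w); last first.
  apply/funext => w; rewrite /= /erlang_time.
  by apply: eq_big_nat => n; rewrite ltnS => ->.
by apply: measurable_sum => n; case: ifP => [/mY//|_]; exact: measurable_cst.
Qed.

(** Almost surely X0 = a and the Erlang time is nonnegative; then the level is
the initial level plus the integral of the rates at all times, and a is carried
to the other side of the inequality. *)
Lemma running_min_level_recenter (R : realType) (S : finType)
    (A : S -> S -> R) (c : S -> R) (nu : R)
    (d : measure_display) (Omega : measurableType d)
    (P : probability Omega R) (phi : R -> Omega -> S)
    (X0 : {mfun Omega >-> R}) (Y : nat -> {mfun Omega >-> R})
    (a x : R) (i : S) (k : nat) :
  0 < nu -> started_from P A c nu phi X0 Y a i ->
  P [set w | running_min (level c phi X0) (erlang_time Y k w) w <= x] =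
  P [set w | running_min (level c phi (cst 0)) (erlang_time Y k w) w <= x - a].
Proof.
move=> nu_gt0 [X0a _ [mphi rc_phi _] [expY indY]].
have mT : measurable_fun setT (erlang_time Y k).
  by apply: (measurable_erlang_time (f := id)) => n _; exact: measurable_funP.
have cX V b w : 0 <= b -> {within `[0, b], continuous (level c phi V ^~ w)}.
  exact: continuous_level.
have mE V y : measurable_fun setT V -> measurable
    [set w | running_min (level c phi V) (erlang_time Y k w) w <= y].
  move=> mV; apply: measurable_running_min_le => // [t t_ge0|b w].
    exact: measurable_level.
  exact: cX.
pose D := \bigcap_(n in [set n | (1 <= n <= k)%N]) (Y n @^-1` `[0, +oo[).
have mX0a : measurable [set w | X0 w = a].
  rewrite (_ : mkset _ = setT `&` X0 @^-1` [set a]); last by rewrite setTI.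
  exact: (measurable_funP X0).
have mD : measurable D.
  apply: bigcap_measurableType => n _.
  by rewrite -[X in measurable X]setTI; exact: measurable_funP.
have PD : P D = 1%E.
  rewrite -[D]setTI indY//; last first.
    exact: (@measurableT _ (g_sigma_algebraType (process_events c phi X0))).
  rewrite probability_setT mul1e big_nat_cond big1// => n /andP[/andP[n_ge1 _] _].
  exact: (etrans (expY n n_ge1 _ _) (exponential_prob_itv0y nu_gt0)).
apply: (@eq_probability_almost_surely _ _ _ P ([set w | X0 w = a] `&` D)).
- exact: measurableI.
- exact: mE.
- exact: mE.
- rewrite -PD; apply: (eq_probability_almost_surely mX0a) => //.
    exact: measurableI.
  by rewrite setIAC setIid setIC.
apply/seteqP; split=> w [Ew [X0w Dw]]; split => //; move: Ew => /=.
all: have T_ge0 : 0 <= erlang_time Y k w by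
  rewrite /erlang_time big_nat_cond sumr_ge0// => n; rewrite andbT => nk;
  have := Dw n nk; rewrite /= in_itv/= andbT.
all: move=> /(running_min_leP _ T_ge0 (cX _ _ w T_ge0))[s s_t Xsx].
all: apply/(running_min_leP _ T_ge0 (cX _ _ w T_ge0)); exists s => //.
all: by move: Xsx; rewrite /level X0w /= add0r lerBrDl.
Qed.

(** Once the initial level is replaced by 0, the event belongs to the
sigma-algebra of the phases and the clock, where the two laws agree. *)
Lemma centred_running_min_law_unique (R : realType) (S : finType)
    (A : S -> S -> R) (c : S -> R) (nu : R)
    (d : measure_display) (Omega : measurableType d)
    (P Q : probability Omega R) (phi : R -> Omega -> S)
    (X0 : {mfun Omega >-> R}) (Y : nat -> {mfun Omega >-> R})
    (a b x : R) (i : S) (k : nat) :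
  started_from P A c nu phi X0 Y a i -> started_from Q A c nu phi X0 Y b i ->
  P [set w | running_min (level c phi (cst 0)) (erlang_time Y k w) w <= x] =
  Q [set w | running_min (level c phi (cst 0)) (erlang_time Y k w) w <= x].
Proof.
move=> startP startQ; apply: (phase_clock_law_unique (k := k) startP startQ).
have [_ _ [_ rc_phi _] _] := startP.
pose T : measurableType _ := g_sigma_algebraType (phase_clock_events phi Y k).
have mphi (t : R) j : 0 <= t -> measurable ([set w | phi t w = j] : set T).
  move=> t_ge0; apply: sub_sigma_algebra.
  exists [:: (t, j)], (fun=> setT); split => //.
    by move=> u; rewrite inE => /eqP->.
  rewrite [X in _ `&` X](_ : _ = setT) ?setIT; last first.
    by apply/seteqP; split => // w _ n _.
  rewrite phase_cylinder_cons [X in _ `&` X](_ : _ = setT) ?setIT//.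
  by apply/seteqP; split.
have mY n : (1 <= n <= k)%N -> measurable_fun setT (Y n \o id : T -> R).
  move=> nk _ B mB; rewrite setTI; apply: sub_sigma_algebra.
  exists [::], (fun m => if m == n then B else setT); split => //.
    by move=> m; case: ifP.
  apply/seteqP; split=> [w Bw|w [_ /(_ n nk)]] /=; last by rewrite eqxx.
  by split => // m _ /=; case: eqP => [->|].
apply: (@measurable_running_min_le R _ T (level c phi (cst 0))) => //.
- by move=> t t_ge0; apply: (@measurable_level R S c _ T).
- by move=> b' w; apply: (@continuous_level R S c _ T).
- exact: (measurable_erlang_time (f := id : T -> Omega)).
Qed.

Theorem lemma5p4 (R : realType) (S : finType)
    (A : S -> S -> R) (c : S -> R) (nu : R) (L : nat)
    (d : measure_display) (Omega : measurableType d)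
    (P : R -> S -> probability Omega R)
    (phi : R -> Omega -> S) (X0 : {mfun Omega >-> R})
    (Y : nat -> {mfun Omega >-> R})
    (c_neq0 : forall i, c i != 0) (nu_gt0 : 0 < nu) (L_ge1 : (1 <= L)%N)
    (P_law : forall a i, started_from (P a i) A c nu phi X0 Y a i)
    (k : nat) (k_range : (1 <= k <= L)%N)
    (a x : R) (a_ge0 : 0 <= a) (x_ge0 : 0 <= x) :
  subvector (phases_up c) (rho_prob P c phi X0 Y a x k) =
    subvector (phases_up c) (eta_prob P c phi X0 Y (x - a) k) /\
  subvector (phases_down c) (rho_prob P c phi X0 Y a x k) =
    subvector (phases_down c) (eta_prob P c phi X0 Y (x - a) k).
Proof.
suff rho_eta i : rho_prob P c phi X0 Y a x k i =
    eta_prob P c phi X0 Y (x - a) k i.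
  by split; apply/ffunP => i; rewrite !ffunE.
have [_ _ [mphi rc_phi _] _] := P_law a i.
rewrite /rho_prob /eta_prob.
rewrite (running_min_level_recenter _ _ nu_gt0 (P_law 0 i)) subr0.
rewrite -(centred_running_min_law_unique _ _ (P_law a i) (P_law 0 i)).
rewrite -(running_min_level_recenter _ _ nu_gt0 (P_law a i)).
congr (P a i _); apply/seteqP; split=> w /=; rewrite running_min_fluid_le//;
  by move=> b; exact: continuous_level.
Qed.
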